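(* Let $l:\mathfrak g\to\mathbb R$ be a (reduced) Lagrangian. The Lagrangian dynamics determined by the Lagrangian submanifold $$s_{\mathfrak z_d}=\left\{\left(ad^*_\xi\frac{\delta l}{\delta\xi},\ \frac{\delta l}{\delta\xi},\ \xi\right)\in\mathfrak z_d:\ \xi\in\mathfrak g\right\}$$ of the reduced Tulczyjew symplectic space $(\mathfrak z_d=\mathcal O_\lambda\times\mathfrak g^*\times\mathfrak g,\ \Omega_{\mathfrak z_d})$ is generated by the Morse family $$E^{l\to h}=(l\circ\tau_{\mathfrak z_d})-\Delta=l(\xi)-\langle\mu,\xi\rangle$$ on the bundle $\mathfrak g\times\mathfrak g^*\to\mathfrak g^*$. Here $\Delta$ is the real-valued function on $\mathfrak g\times\mathfrak g^*$ obtained from the equation $\chi_2-\chi_1=d\Delta=d\langle\mu,\xi\rangle$, where $\chi_1,\chi_2$ are the two potential one-forms of $\Omega_{\mathfrak z_d}$.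
   Context: $G$ is a Lie group with Lie algebra $\mathfrak g$, assumed reflexive, and dual $\mathfrak g^*$. With $I_g(h)=g^{-1}hg$, put $Ad_g=T_eI_g$ (right adjoint action); $ad_\xi\eta=[\xi,\eta]$ is its infinitesimal version. $Ad^*_g$ is defined by $\langle Ad^*_g\mu,\xi\rangle=\langle\mu,Ad_{g^{-1}}\xi\rangle$, and $ad^*_\xi$ by $\langle ad^*_\xi\mu,\eta\rangle=\langle\mu,[\xi,\eta]\rangle$. $\mathcal O_\lambda$ is the coadjoint orbit through $\lambda\in\mathfrak g^*$. $\delta l/\delta\xi\in\mathfrak g^*$ is the derivative of $l$ at $\xi$. The set $s_{\mathfrak z_d}$ defines the Euler-Poincaré equations $\frac{d}{dt}\frac{\delta l}{\delta\xi}=ad^*_\xi\frac{\delta l}{\delta\xi}$. Points of $\mathfrak z_d=\mathcal O_\lambda\times\mathfrak g^*\times\mathfrak g$ are written $(Ad^*_{g^{-1}}\lambda,\mu,\xi)$, and $\tau_{\mathfrak z_d}:\mathfrak z_d\to\mathfrak g$, $\pi_{\mathfrak z_d}:\mathfrak z_d\to\mathfrak g^*$ are the projections to $\xi$ and $\mu$. For $\eta,\zeta\in\mathfrak g$, $\upsilon\in\mathfrak g^*$ there is the vector field on $\mathfrak z_d$ $$X_{(\eta,\upsilon,\zeta)}(Ad^*_{g^{-1}}\lambda,\mu,\xi)=\left(ad^*_\eta\circ Ad^*_{g^{-1}}\lambda,\ \upsilon+ad^*_\eta\mu,\ \zeta+[\xi,\eta]\right).$$ The exact symplectic form $\Omega_{\mathfrak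 z_d}=d\chi_1=d\chi_2$ and its potentials are given at $(Ad^*_{g^{-1}}\lambda,\mu,\xi)$ by $$\Omega_{\mathfrak z_d}(X_{(\eta,\upsilon,\zeta)},X_{(\bar\eta,\bar\upsilon,\bar\zeta)})=\langle\upsilon,\bar\zeta\rangle-\langle\bar\upsilon,\zeta\rangle-\langle\lambda,[\eta,\bar\eta]\rangle,$$ $$\langle\chi_1,X_{(\eta,\upsilon,\zeta)}\rangle=\langle\lambda,\eta\rangle-\langle\upsilon,\xi\rangle,\qquad\langle\chi_2,X_{(\eta,\upsilon,\zeta)}\rangle=\langle\lambda,\eta\rangle+\langle\mu,\zeta\rangle.$$ The canonically symplectic space $T^*\mathfrak g^*=\mathfrak g^*\times\mathfrak g$ is embedded symplectically in $\mathfrak z_d$ by $\hat\omega:T^*\mathfrak g^*\to\mathfrak z_d$, $\hat\omega(\mu,\xi)=(ad^*_\xi\mu,\mu,\xi)$. That $E^{l\to h}$ generates $s_{\mathfrak z_d}$ means that it generates a Lagrangian submanifold $s_{T^*\mathfrak g^*}$ of $T^*\mathfrak g^*$, consisting of the pairs $(\delta l/\delta\xi,\xi)$, whose image under $\hat\omega$ is $s_{\mathfrak z_d}$. Morse families: for a fibre bundle $\pi:\mathcal P\to\mathcal M$, let $V\mathcal P=\ker T\pi$ and let $V^0\mathcal P\subset T^*\mathcal P$ be the covectors annihilating $V\mathcal P$. A function $E:\mathcal P\to\mathbb R$ is a Morse family if $T_z\,\mathrm{im}(dE)+T_zV^0\mathcal P=T_zT^*\mathcal P$ for all $z\in\mathrm{im}(dE)\cap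 V^0\mathcal P$. It generates the immersed Lagrangian submanifold of $T^*\mathcal M$ consisting of the covectors $\lambda_{\mathcal M}$ at points $\pi(p)$ with $T^*\pi(\lambda_{\mathcal M})=dE(p)$, $p\in\mathcal P$.
   Formalization: Since ad*_ξ μ need not lie in O_λ, ω̂ takes values in g*×g*×g: the image of {(δl/δξ,ξ)} is the set of all triples, and s_{z_d} is its part in z_d; the Lagrangian property is stated in T*g*, not in (z_d,Ω), where it fails in general. G is a Banach–Lie group. *)

(* Defs.v *)
From HB Require Import structures.
From mathcomp Require Import all_boot all_order all_algebra.
From mathcomp Require Import mathcomp_extra boolp classical_sets functions reals.
From mathcomp Require Import topology normedtype landau derive.

Set Implicit Arguments.
Unset Strict Implicit.
Unset Printing Implicit Defensive.

Import Order.TTheory GRing.Theory Num.Theory.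
Import numFieldNormedType.Exports.

Local Open Scope classical_set_scope.
Local Open Scope ring_scope.

Section ContinuousLinearMaps.
Context {R : realType} (V W : normedModType R).

Definition clin_pred : {pred V -> W} :=
  fun f => `[< (forall a u v, f (a *: u + v) = a *: f u + f v) /\ continuous f >].

Record clin := Clin { clin_fun :> V -> W; clinP : clin_fun \in clin_pred }.

HB.instance Definition _ := [isSub for clin_fun].
HB.instance Definition _ := [Choice of clin by <:].

Lemma clin_predP (f : V -> W) :
  f \in clin_pred <->
  (forall a u v, f (a *: u + v) = a *: f u + f v) /\ continuous f.
Proof. by split=> [/asboolP|?]; last exact/asboolP. Qed.

Lemma clin_submod_closed : submod_closed clin_pred.
Proof.
split.
  apply/clin_predP; split=> [a u v|]; first by rewrite scaler0 addr0.
  exact: cst_continuous.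
move=> a f h /clin_predP[lf cf] /clin_predP[lh ch]; apply/clin_predP; split.
  move=> b u v; rewrite !fctE lf lh scalerDr !scalerDr !scalerA (mulrC a b).
  by rewrite addrACA.
move=> x; rewrite /continuous_at.
by apply: cvgD; [apply: cvgZl_tmp; exact: cf | exact: ch].
Qed.

HB.instance Definition _ :=
  GRing.isSubmodClosed.Build R (V -> W) clin_pred clin_submod_closed.
HB.instance Definition _ := [SubChoice_isSubLmodule of clin by <:].

Implicit Types f h : clin.

Lemma clinD f h x : (f + h) x = f x + h x. Proof. by []. Qed.
Lemma clinZ a f x : (a *: f) x = a *: f x. Proof. by []. Qed.
Lemma clin_eqP f h : f =1 h -> f = h.
Proof. by move=> fh; apply: val_inj; apply: funext. Qed.

Lemma clin_linear f : linear f.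
Proof. by move=> a u v; have /clin_predP[-> _] := clinP f. Qed.

Lemma clin_continuous f : continuous f.
Proof. by have /clin_predP[] := clinP f. Qed.

HB.instance Definition _ f := GRing.isLinear.Build R V W _ f (clin_linear f).

Definition opnorm f : R := sup [set `|f x| | x in [set x : V | `|x| <= 1]].

Lemma opnorm_has_sup f : has_sup [set `|f x| | x in [set x : V | `|x| <= 1]].
Proof.
split; first by exists `|f 0|, 0 => //=; rewrite normr0.
have /linear_bounded_continuous/bounded_funP/(_ 1)[M Mf] := @clin_continuous f.
by exists M => _ [x /= x1 <-]; exact: Mf.
Qed.

Lemma opnorm_ub f x : `|x| <= 1 -> `|f x| <= opnorm f.
Proof. by move=> x1; apply: (ub_le_sup (opnorm_has_sup f).2); exists x. Qed.

Lemma opnorm_le f M : (forall x, `|x| <= 1 -> `|f x| <= M) -> opnorm f <= M.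
Proof.
move=> fM; apply: ge_sup; first exact: (opnorm_has_sup f).1.
by move=> _ [x /= x1 <-]; exact: fM.
Qed.

Lemma opnormD f h : opnorm (f + h) <= opnorm f + opnorm h.
Proof.
apply: opnorm_le => x x1; rewrite clinD (le_trans (ler_normD _ _))//.
by rewrite lerD// opnorm_ub.
Qed.

Lemma opnormZ a f : opnorm (a *: f) = `|a| * opnorm f.
Proof.
have le b k : opnorm (b *: k) <= `|b| * opnorm k.
  apply: opnorm_le => x x1; rewrite clinZ normrZ.
  by rewrite ler_wpM2l// opnorm_ub.
apply/eqP; rewrite eq_le le/=.
have [->|a0] := eqVneq a 0.
  rewrite normr0 mul0r (le_trans _ (opnorm_ub (0 *: f) (x := 0) _))//.
  by rewrite normr0.
rewrite -ler_pdivlMl ?normr_gt0// -normfV.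
by apply: le_trans (le _ _); rewrite scalerA mulVf// scale1r.
Qed.

Lemma opnorm0_eq0 f : opnorm f = 0 -> f = 0.
Proof.
move=> f0; apply: clin_eqP => x; have [->|x0] := eqVneq x 0.
  by rewrite linear0.
have nx1 : `|(`|x|^-1 *: x)| <= 1.
  by rewrite normrZ normfV normr_id mulVf// normr_eq0.
have := opnorm_ub f nx1.
rewrite f0 normr_le0 linearZ/= scaler_eq0 invr_eq0 normr_eq0 (negbTE x0)/=.
by move/eqP.
Qed.

HB.instance Definition _ :=
  Lmodule_isNormed.Build R clin opnormD opnormZ opnorm0_eq0.

(* Junk value 0 when f is not linear or not continuous. *)
Definition mkclin (f : V -> W) : clin := insubd (0 : clin) f.

Lemma mkclinE (f : V -> W) : linear f -> continuous f -> mkclin f = f :> (V -> W).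
Proof. by move=> lf cf; rewrite /mkclin insubdK//; exact/clin_predP. Qed.

Definition frechet (f : V -> W) (x : V) : clin := mkclin ('d f x).

Lemma frechetE (f : V -> W) (x : V) :
  differentiable f x -> frechet f x = 'd f x :> (V -> W).
Proof.
move=> df; rewrite mkclinE//; last exact: diff_continuous.
by move=> a u v; rewrite linearP.
Qed.

End ContinuousLinearMaps.

Notation dual_space V := (clin V _^o).

Section Smoothness.
Context {R : realType}.

(* Class C^n on the open set U, in the sense of Frechet: the derivative is a
   map into the continuous linear maps with the operator norm. *)
Fixpoint Cn (n : nat) (V W : normedModType R) (U : set V) (f : V -> W) : Prop :=
  match n with
  | 0 => forall x, U x -> {for x, continuous f}
  | n'.+1 => (forall x, U x -> differentiable f x) /\ Cn n' U (frechet f)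
  end.

Definition smooth_on (V W : normedModType R) (U : set V) (f : V -> W) : Prop :=
  forall n, Cn n U f.

Definition smooth (V W : normedModType R) (f : V -> W) : Prop :=
  smooth_on setT f.

Definition bidual_map (V : normedModType R) (x : V)
    : dual_space (dual_space V) := mkclin (fun mu : dual_space V => mu x).

Lemma bidual_mapE (V : normedModType R) (x : V) (mu : dual_space V) :
  bidual_map x mu = mu x.
Proof.
pose ev (nu : dual_space V) : R^o := nu x.
have lev : linear ev by move=> a u v; rewrite /ev clinD clinZ.
pose evL := GRing.isLinear.Build R (dual_space V) R^o _ ev lev.
pose ev' : {linear dual_space V -> R^o} := HB.pack ev evL.
rewrite /bidual_map mkclinE// -[X in continuous X]/(ev' : _ -> _).
apply/linear_bounded_continuous/linear_boundedP.
exists `|x|; split=> [|r xr nu]; first exact: num_real.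
apply: le_trans (_ : opnorm nu * `|x| <= _); last first.
  by rewrite mulrC -[opnorm nu]/(`|nu|) ler_wpM2r// ltW.
rewrite -[ev' nu]/(nu x).
have [->|x0] := eqVneq x 0; first by rewrite linear0 !normr0 mulr0.
have nx1 : `|(`|x|^-1 *: x)| <= 1.
  by rewrite normrZ normfV normr_id mulVf// normr_eq0.
have := opnorm_ub nu nx1.
by rewrite linearZ normrZ normfV normr_id ler_pdivrMl ?normr_gt0// mulrC.
Qed.

(* The canonical map into the bidual is an isomorphism of topological vector
   spaces. *)
Definition reflexive_space (V : normedModType R) : Prop :=
  exists j : clin (dual_space (dual_space V)) V,
    cancel (@bidual_map V) j /\ cancel j (@bidual_map V).

End Smoothness.

Section LieGroups.
Context {R : realType}.

(* A chart is a bijection of cdom onto an open subset of the model space, with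
   inverse cinv there; outside of these sets the functions are arbitrary. *)
Record chart (G : Type) (V : Type) := Chart {
  cdom : set G;
  cmap : G -> V;
  cinv : V -> G }.

Definition cimg (G V : Type) (c : chart G V) : set V := cmap c @` cdom c.

(* The topology of a manifold is the one induced by its atlas. *)
Definition manifold_open (G : Type) (V : normedModType R)
    (A : set (chart G V)) (U : set G) : Prop :=
  forall c, A c -> open (cmap c @` (cdom c `&` U)).

Record smooth_atlas (G : Type) (V : normedModType R) (A : set (chart G V))
    : Prop := SmoothAtlas {
  atlas_cover : forall x, exists2 c, A c & cdom c x;
  atlas_inv : forall c x, A c -> cdom c x -> cinv c (cmap c x) = x;
  atlas_open : forall c c', A c -> A c' ->
    open (cmap c @` (cdom c `&` cdom c'));
  atlas_compat : forall c c', A c -> A c' ->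
    smooth_on (cmap c @` (cdom c `&` cdom c')) (cmap c' \o cinv c);
  atlas_hausdorff : forall x y, x <> y ->
    exists U U' : set G, [/\ manifold_open A U, manifold_open A U',
                             U x, U' y & U `&` U' = set0] }.

(* Lie group modelled on the Banach space V. The chart chart1 serves to identify
   the tangent space at the identity, that is, the Lie algebra, with V. *)
Record lie_group (G : groupType) (V : completeNormedModType R) := LieGroup {
  atlas : set (chart G V);
  atlasP : smooth_atlas atlas;
  mul_smooth : forall c c' c'' g h, atlas c -> atlas c' -> atlas c'' ->
    cdom c g -> cdom c' h -> cdom c'' (g * h)%g ->
    exists O : set (V * V),
      [/\ open O, O (cmap c g, cmap c' h),
          (forall p, O p -> [/\ cimg c p.1, cimg c' p.2 &
                               cdom c'' (cinv c p.1 * cinv c' p.2)%g]) &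
          smooth_on O (fun p => cmap c'' (cinv c p.1 * cinv c' p.2)%g)];
  inv_smooth : forall c c' g, atlas c -> atlas c' ->
    cdom c g -> cdom c' (g^-1)%g ->
    exists O : set V,
      [/\ open O, O (cmap c g),
          (forall x, O x -> cimg c x /\ cdom c' ((cinv c x)^-1)%g) &
          smooth_on O (fun x => cmap c' ((cinv c x)^-1)%g)];
  chart1 : chart G V;
  chart1_atlas : atlas chart1;
  chart1_id : cdom chart1 1%g }.

Section Adjoint.
Context (G : groupType) (g : completeNormedModType R) (L : lie_group G g).

Let phi : G -> g := cmap (chart1 L).
Let psi : g -> G := cinv (chart1 L).

Definition conjugation (a h : G) : G := (a^-1 * h * a)%g.

Definition Ad (a : G) : g -> g :=
  'd (fun x : g => phi (conjugation a (psi x))) (phi 1%g).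

Definition bracket (xi eta : g) : g :=
  'd (fun x : g => Ad (psi x) eta) (phi 1%g) xi.

Definition Ad_star (a : G) (mu : dual_space g) : dual_space g :=
  mkclin (fun xi => mu (Ad (a^-1)%g xi)).

Definition ad_star (xi : g) (mu : dual_space g) : dual_space g :=
  mkclin (fun eta => mu (bracket xi eta)).

Definition coadjoint_orbit (lambda : dual_space g) : set (dual_space g) :=
  [set Ad_star (a^-1)%g lambda | a in setT].

End Adjoint.

End LieGroups.

Section SymplecticGeometry.
Context {R : realType}.

(* Velocities at p of the smooth curves in S. *)
Definition tangent (W : normedModType R) (S : set W) (p : W) : set W :=
  [set v | exists (O : set R^o) (gamma : R^o -> W),
    [/\ open O, O 0, smooth_on O gamma, (forall t, O t -> S (gamma t)) &
        gamma 0 = p /\ 'd gamma 0 1 = v]].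

(* Around each of its points, S is straightened by a diffeomorphism from an
   open set of W onto an open set of a product. *)
Definition submanifold (W : normedModType R) (S : set W) : Prop :=
  forall p, S p -> exists (F1 F2 : normedModType R) (O : set W)
      (O' : set (F1 * F2)) (Phi : W -> F1 * F2) (Psi : F1 * F2 -> W),
    [/\ [/\ open O, O p & open O'],
        (forall w, O w -> O' (Phi w) /\ Psi (Phi w) = w),
        (forall q, O' q -> O (Psi q) /\ Phi (Psi q) = q),
        smooth_on O Phi /\ smooth_on O' Psi &
        forall w, O w -> (S w <-> (Phi w).2 = 0)].

Definition lagrangian (W : normedModType R) (omega : W -> W -> R^o)
    (S : set W) : Prop :=
  submanifold S /\
  forall p, S p ->
    tangent S p = [set v | forall u, tangent S p u -> omega v u = 0].

(* For a vector space M, T^*M is M * M^*, with Liouville form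
   theta_(m, alpha) (dm, dalpha) = alpha dm; this is d theta. *)
Definition canonical_form (M : normedModType R) (u v : M * dual_space M) : R^o :=
  u.2 v.1 - v.2 u.1.

Section MorseFamilies.
(* pi is the projection of a fibre bundle; T^*P is P * P^*. *)
Context (P M : normedModType R) (pi : P -> M).

Definition vertical (p : P) : set P := [set v | 'd pi p v = 0].

Definition vertical_annihilator : set (P * dual_space P) :=
  [set z : P * dual_space P | forall v, vertical z.1 v -> z.2 v = 0].

Definition im_d (E : P -> R^o) : set (P * dual_space P) :=
  [set (p, frechet E p) | p in setT].

Definition morse_family (E : P -> R^o) : Prop :=
  smooth E /\
  forall z, (im_d E `&` vertical_annihilator) z ->
    forall w, exists u v, [/\ tangent (im_d E) z u,
                              tangent vertical_annihilator z v & w = u + v].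

Definition generated (E : P -> R^o) : set (M * dual_space M) :=
  [set z : M * dual_space M |
    exists2 p, pi p = z.1 & forall v, z.2 ('d pi p v) = 'd E p v].

End MorseFamilies.

End SymplecticGeometry.

Section ReducedTulczyjew.
Context {R : realType} (G : groupType) (g : completeNormedModType R).

(* Points (rho, mu, xi), with rho in the coadjoint orbit of lambda. *)
Notation ambient := (dual_space g * dual_space g * g)%type.

Definition tau_zd (z : ambient) : g := z.2.
Definition pi_zd (z : ambient) : dual_space g := z.1.2.

Definition canonical_Tgstar (u v : dual_space g * g) : R^o :=
  u.1 v.2 - v.1 u.2.

(* The identification of g^* * g with T^*(g^* ) = g^* * g^**. The sign is the one
   under which the Liouville form becomes - <dmu, xi>, the (mu, xi) part of the
   potential chi1, and canonical_form becomes canonical_Tgstar. *)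
Definition covector (p : dual_space g * g) :
    dual_space g * dual_space (dual_space g) :=
  (p.1, - bidual_map p.2).

Lemma covector_symplectic (u v : dual_space g * g) :
  canonical_form (covector u) (covector v) = canonical_Tgstar u v.
Proof.
have E (x : g) (mu : dual_space g) : (- bidual_map x) mu = - mu x.
  by rewrite -[LHS]/(- bidual_map x mu) bidual_mapE.
transitivity (- (v.1 u.2) - - (u.1 v.2)); last by rewrite opprK addrC.
exact: (congr2 (fun a b : R^o => a - b) (E u.2 v.1) (E v.2 u.1)).
Qed.

Definition s_Tgstar (l : g -> R^o) : set (dual_space g * g) :=
  [set (frechet l xi, xi) | xi in setT].

Definition Delta (p : g * dual_space g) : R^o := p.2 p.1.

(* l o tau_zd - Delta, seen on g * g^*. *)
Definition E_lh (l : g -> R^o) (p : g * dual_space g) : R^o := l p.1 - Delta p.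

Context (L : lie_group G g) (lambda : dual_space g).

Definition zd : set ambient := [set z | coadjoint_orbit L lambda z.1.1].

Definition X_field (eta : g) (ups : dual_space g) (zeta : g) (z : ambient)
    : ambient :=
  (ad_star L eta z.1.1, ups + ad_star L eta (pi_zd z),
   zeta + bracket L (tau_zd z) eta).

(* The values at z, in terms of (eta, ups, zeta), of the potential one-forms on X_field eta ups zeta. *)
Definition chi1 (z : ambient) (eta : g) (ups : dual_space g) (zeta : g) : R^o :=
  lambda eta - ups (tau_zd z).
Definition chi2 (z : ambient) (eta : g) (ups : dual_space g) (zeta : g) : R^o :=
  lambda eta + pi_zd z zeta.

(* chi2 - chi1 = d D on z_d, where D : g * g^* -> R is pulled back to z_d. *)
Definition potential_difference (D : g * dual_space g -> R^o) : Prop :=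
  smooth D /\
  forall z, zd z -> forall eta ups zeta,
    chi2 z eta ups zeta - chi1 z eta ups zeta =
    'd (fun q : ambient => D (tau_zd q, pi_zd q)) z (X_field eta ups zeta z).

Definition omega_hat (p : dual_space g * g) : ambient :=
  (ad_star L p.2 p.1, p.1, p.2).

(* All the triples (ad^*_xi dl/dxi, dl/dxi, xi), before restriction to z_d. *)
Definition euler_poincare (l : g -> R^o) : set ambient :=
  [set (ad_star L xi (frechet l xi), frechet l xi, xi) | xi in setT].

Definition s_zd (l : g -> R^o) : set ambient := zd `&` euler_poincare l.

End ReducedTulczyjew.

(* Main.v *)
Require Import Defs.
From HB Require Import structures.
From mathcomp Require Import all_boot all_order all_algebra.
From mathcomp Require Import mathcomp_extra boolp classical_sets functions reals.
From mathcomp Require Import ring.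
From mathcomp Require Import prodnormedzmodule topology normedtype landau derive.
Import Order.TTheory GRing.Theory Num.Theory.
Import numFieldNormedType.Exports.
Local Open Scope classical_set_scope.
Local Open Scope ring_scope.

(** The Lagrangian submanifold of the Euler-Poincare dynamics is the graph of dl,
    and the Morse family E(xi, mu) = l(xi) - <mu, xi> is the usual one of a
    Legendre transformation. Everything rests on two symmetries, both instances
    of Schwarz's theorem (schwarz), which is proved here from the mean value
    theorem.

    The symmetry of the second derivative of l makes the graph of dl Lagrangian
    in g^* * g (lagrangian_s_Tgstar): its tangent spaces are the graphs of that
    second derivative. The critical points of E along the fibre over mu are the
    xi with mu = dl xi, and the derivative of E in mu is - xi, so E generates the
    image of this graph under the identification covector (generatedE), which is
    a linear symplectic isomorphism because g is reflexive
    (lagrangian_generated). E is a Morse family because the mixed derivative of E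
    in xi and mu is minus the duality pairing, which already fills the directions
    transverse to V^0 (morse_family_E).

    The symmetry of the second derivative of the group multiplication, read in
    the chart at the identity, makes the bracket antisymmetric
    (bracket_antisym), once bracketE has expressed the bracket, defined as the
    derivative of Ad, through the mixed second derivative of the multiplication.
    Antisymmetry is what makes d<mu, xi> vanish along the coadjoint and adjoint
    parts of X_(eta, ups, zeta) taken together, hence chi2 - chi1 = d Delta
    (potential_differenceP). Conversely the fields X_(0, ups, zeta) span all
    directions of g * g^*, which fixes Delta up to a constant.

    The class of smooth maps is handled through Cn_comp and the fact that bounded
    linear and bilinear maps are smooth. *)

Set Implicit Arguments.
Unset Strict Implicit.
Unset Printing Implicit Defensive.

(** * Bounded linear and bilinear maps *)

Section BoundedLinearMaps.
Context {R : realType}.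
Implicit Types V W Z : normedModType R.

Lemma bounded_clin_pred V W (f : V -> W) M :
  linear f -> (forall x, `|f x| <= M * `|x|) -> f \in @clin_pred R V W.
Proof.
move=> lf fM; apply/clin_predP; split=> //.
pose fM' := GRing.isLinear.Build R V W _ f lf.
pose f' : {linear V -> W} := HB.pack f fM'.
rewrite -[f]/(f' : _ -> _); apply/linear_bounded_continuous/linear_boundedP.
exists M; split=> [|r Mr x]; first exact: num_real.
by apply: le_trans (fM x) _; rewrite ler_wpM2r// ltW.
Qed.

(** Unlike mkclin, bclin reduces when applied, so the values of the maps built
    from it are known by computation. *)
Definition bclin V W (f : V -> W) M (lf : linear f)
  (fM : forall x, `|f x| <= M * `|x|) : clin V W :=
  Clin (bounded_clin_pred lf fM).

Lemma clin_norm_le V W (A : clin V W) x : `|A x| <= `|A| * `|x|.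
Proof.
have [->|x0] := eqVneq x 0; first by rewrite linear0 !normr0 mulr0.
have nx1 : `|(`|x|^-1 *: x)| <= 1.
  by rewrite normrZ normfV normr_id mulVf// normr_eq0.
have := opnorm_ub A nx1.
by rewrite linearZ normrZ normfV normr_id ler_pdivrMl ?normr_gt0// mulrC.
Qed.

Lemma clin_norm_leP V W (A : clin V W) M : 0 <= M ->
  (forall x, `|A x| <= M * `|x|) -> `|A| <= M.
Proof.
move=> M0 AM; apply: opnorm_le => x x1; apply: le_trans (AM x) _.
by rewrite ler_piMr.
Qed.

Definition clin_id V : clin V V.
Proof. by apply: (@bclin _ _ id 1) => // x; rewrite mul1r. Defined.

Definition clin_fst V W : clin (V * W)%type V.
Proof.
apply: (@bclin _ _ fst 1) => // x.
by rewrite mul1r prod_normE/= le_max lexx.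
Defined.

Definition clin_snd V W : clin (V * W)%type W.
Proof.
apply: (@bclin _ _ snd 1) => // x.
by rewrite mul1r prod_normE/= le_max lexx orbT.
Defined.

Definition clin_comp V W Z (A : clin W Z) (B : clin V W) : clin V Z.
Proof.
apply: (@bclin _ _ (fun x => A (B x)) (`|A| * `|B|)) => [a u v|x].
  by rewrite !linearP.
apply: le_trans (clin_norm_le A _) _; rewrite -mulrA ler_wpM2l//.
exact: clin_norm_le.
Defined.

Definition clin_pair V W Z (A : clin V W) (B : clin V Z) : clin V (W * Z)%type.
Proof.
apply: (@bclin _ _ (fun x => (A x, B x)) (Num.max `|A| `|B|)) => [a u v|x].
  by rewrite !linearP.
rewrite prod_normE/= ge_max; apply/andP; split.
  apply: le_trans (clin_norm_le _ _) _.
  by rewrite ler_wpM2r// le_max lexx.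
apply: le_trans (clin_norm_le _ _) _.
by rewrite ler_wpM2r// le_max lexx orbT.
Defined.

Lemma clin_compE V W Z (A : clin W Z) (B : clin V W) x :
  clin_comp A B x = A (B x).
Proof. by []. Qed.

Lemma clin_pairE V W Z (A : clin V W) (B : clin V Z) x :
  clin_pair A B x = (A x, B x).
Proof. by []. Qed.

Lemma clin_comp_norm V W Z (A : clin W Z) (B : clin V W) :
  `|clin_comp A B| <= `|A| * `|B|.
Proof.
apply: clin_norm_leP => [|x]; first by rewrite mulr_ge0.
apply: le_trans (clin_norm_le A _) _; rewrite -mulrA ler_wpM2l//.
exact: clin_norm_le.
Qed.

Definition clin_postcomp V W Z (A : clin W Z) : clin (clin V W) (clin V Z).
Proof.
apply: (@bclin _ _ (fun B => clin_comp A B) `|A|) => [a B C|B].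
  by apply: clin_eqP => x; rewrite clinD clinZ !clin_compE clinD clinZ linearP.
exact: clin_comp_norm.
Defined.

Definition clin_composition V W Z :
  clin (clin W Z) (clin (clin V W) (clin V Z)).
Proof.
apply: (@bclin _ _ (fun A => clin_postcomp V A) 1) => [a A B|A].
  by apply: clin_eqP => C; apply: clin_eqP.
rewrite mul1r; apply: clin_norm_leP => // B; exact: clin_comp_norm.
Defined.

Definition clin_pairing V W Z :
  clin (clin V W * clin V Z)%type (clin V (W * Z)%type).
Proof.
apply: (@bclin _ _ (fun p => clin_pair p.1 p.2) 1) => [a p q|p].
  by apply: clin_eqP.
rewrite mul1r; apply: clin_norm_leP => // x.
rewrite !prod_normE/= ge_max; apply/andP; split.
  apply: le_trans (clin_norm_le _ _) _.
  by rewrite ler_wpM2r// le_max lexx.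
apply: le_trans (clin_norm_le _ _) _.
by rewrite ler_wpM2r// le_max lexx orbT.
Defined.

(** Exchanging the arguments of a bounded bilinear map turns the identity into
    evaluation at a point, and composition into precomposition. *)
Section Flip.
Context (V W Z : normedModType R) (B : clin V (clin W Z)).

Let eval_linear w : linear (fun v => B v w).
Proof. by move=> a u v; rewrite linearP. Qed.

Let eval_bound w v : `|B v w| <= `|B| * `|w| * `|v|.
Proof.
apply: le_trans (clin_norm_le _ _) _; rewrite mulrAC ler_wpM2r//.
exact: clin_norm_le.
Qed.

Definition clin_flip : clin W (clin V Z).
Proof.
apply: (@bclin _ _ (fun w => bclin (eval_linear w) (eval_bound w)) `|B|).
  by move=> a v w; apply: clin_eqP => x; rewrite clinD clinZ/= linearP.
by move=> w; apply: clin_norm_leP => [|v]; [exact: mulr_ge0|exact: eval_bound].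
Defined.

End Flip.

(** A bounded bilinear map is encoded as a bounded linear map into bounded
    linear maps, so that its two partial maps are bounded by construction. Its
    differential is then again linear in the base point. *)
Section Bilinear.
Context {V W Z : normedModType R}.
Context (B : clin V (clin W Z)).

Definition uncurry (p : V * W) : Z := B p.1 p.2.

Definition uncurry_diff : clin (V * W)%type (clin (V * W)%type Z) :=
  clin_comp (clin_flip (clin_composition _ _ _) (clin_snd V W))
            (clin_comp B (clin_fst V W))
  + clin_comp (clin_flip (clin_composition _ _ _) (clin_fst V W))
              (clin_comp (clin_flip B) (clin_snd V W)).

Lemma uncurry_diffE p q :
  uncurry_diff p q = B p.1 q.2 + B q.1 p.2.
Proof. by []. Qed.

End Bilinear.
End BoundedLinearMaps.

(** * Frechet differentials *)

Section FrechetDerivative.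
Context {R : realType}.
Implicit Types V W Z : normedModType R.

(** The little-o definition of the differential, restated with explicit
    constants. *)
Lemma is_diff_eps V W (f : V -> W) (A : clin V W) x :
  (forall e, 0 < e ->
     \forall h \near 0, `|f (h + x) - f x - A h| <= e * `|h|) ->
  is_diff x f A.
Proof.
move=> fA.
have fxA : f \o shift x = cst (f x) + A +o_ 0 id.
  apply/eqaddoP => e e0; apply: filterS (fA e e0) => h /=.
  by rewrite !fctE opprD addrA.
have dfA : 'd f x = A :> (V -> W).
  by apply: diff_unique fxA; exact: clin_continuous.
split=> //; apply/diff_locallyP; rewrite dfA; split=> //.
exact: clin_continuous.
Qed.

Lemma diff_eps V W (f : V -> W) x : differentiable f x ->
  forall e, 0 < e ->
     \forall h \near 0, `|f (h + x) - f x - 'd f x h| <= e * `|h|.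
Proof.
move=> /diff_locally/eqaddoP fA e e0; apply: filterS (fA e e0) => h /=.
by rewrite !fctE opprD addrA.
Qed.

Lemma frechet_is_diff V W (f : V -> W) (A : clin V W) x :
  is_diff x f A -> frechet f x = A.
Proof.
by move=> [df dfA]; apply: clin_eqP => v; rewrite frechetE// dfA.
Qed.

Lemma is_diff_frechet V W (f : V -> W) x :
  differentiable f x -> is_diff x f (frechet f x).
Proof. by move=> df; apply: DiffDef; rewrite // frechetE. Qed.

(** Differentials only see germs; the group operations read in a chart are
    controlled only near the identity. *)
Lemma near_is_diff V W (f f' : V -> W) (df : V -> W) x :
  {near x, f =1 f'} -> is_diff x f df -> is_diff x f' df.
Proof.
move=> ff' [dfx <-]; rewrite -(frechetE dfx); apply: is_diff_eps => e e0.
have fxE : f x = f' x := nbhs_singleton ff'.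
have : \forall h \near (0 : V), f (h + x) = f' (h + x).
  have : \forall y \near x, f y = f' y := ff'.
  by rewrite (near_shift 0 x); apply: filterS => h; rewrite /= subr0.
have := diff_eps dfx e0; apply: filterS2 => h /= + fh.
by rewrite frechetE// -fh fxE.
Qed.

Lemma is_diff_clin V W (A : clin V W) x : is_diff x A A.
Proof.
apply: DiffDef; first exact/linear_differentiable/clin_continuous.
by rewrite diff_lin//; exact: clin_continuous.
Qed.

(** The remainder is B(h1, h2), which is quadratic in h. *)
Lemma is_diff_uncurry V W Z (B : clin V (clin W Z)) p :
  is_diff p (uncurry B) (uncurry_diff B p).
Proof.
apply: is_diff_eps => e e0.
have B1 : 0 < `|B| + 1 by rewrite ltr_wpDl.
have : \forall h \near (0 : V * W), `|h| <= e / (`|B| + 1).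
  apply/nbhs_normP; exists (e / (`|B| + 1)); first by rewrite /= divr_gt0.
  by move=> h /=; rewrite sub0r normrN => /ltW.
apply: filterS => h he.
have -> : uncurry B (h + p) - uncurry B p - uncurry_diff B p h = B h.1 h.2.
  have -> : uncurry B (h + p) = B h.1 h.2 + B h.1 p.2 + (B p.1 h.2 + B p.1 p.2).
    by rewrite /uncurry/= (linearD B) clinD !linearD.
  rewrite uncurry_diffE -[uncurry B p]/(B p.1 p.2) addrA addrK.
  by rewrite (addrC (B p.1 h.2)) -[X in X - _]addrA addrK.
apply: le_trans (clin_norm_le _ _) _.
apply: le_trans (_ : (`|B| * `|h|) * `|h| <= _).
  apply: ler_pM => //; last by rewrite prod_normE le_max lexx orbT.
  apply: le_trans (clin_norm_le _ _) _; rewrite ler_wpM2l//.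
  by rewrite prod_normE le_max lexx.
rewrite ler_wpM2r//; apply: le_trans (_ : (`|B| + 1) * `|h| <= _).
  by rewrite ler_wpM2r// lerDl.
by rewrite mulrC -ler_pdivlMr.
Qed.

End FrechetDerivative.

(** * Maps of class C^n *)

Section ClassCn.
Context {R : realType}.
Implicit Types V W Z : normedModType R.

Lemma open_near_eq V W (U : set V) (f f' : V -> W) x : open U -> U x ->
  (forall y, U y -> f y = f' y) -> {near x, f =1 f'}.
Proof. by move=> oU Ux ff'; apply: filterS (open_nbhs_nbhs (conj oU Ux)). Qed.

Lemma eq_Cn n V W (U : set V) (f f' : V -> W) : open U ->
  (forall x, U x -> f x = f' x) -> Cn n U f -> Cn n U f'.
Proof.
move=> oU; elim: n W f f' => [|n IH] W f f' ff' /=.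
  move=> cf x Ux; rewrite /prop_for /continuous_at -(ff' _ Ux).
  apply: cvg_trans (cf x Ux); apply: near_eq_cvg.
  exact: open_near_eq oU Ux ff'.
have dff' x : U x -> differentiable f x -> is_diff x f' (frechet f x).
  move=> Ux df; apply: (near_is_diff (open_near_eq oU Ux ff')).
  exact: is_diff_frechet.
move=> [df cf]; split=> [x Ux|].
  exact: (@ex_diff _ _ _ _ _ _ _ (dff' x Ux (df x Ux))).
apply: IH cf => x Ux; apply/esym/frechet_is_diff/dff' => //; exact: df.
Qed.

(** To be of class C^(n+1) it is enough to exhibit a differential of class C^n;
    frechet need not be computed. *)
Lemma Cn_diff n V W (U : set V) (f : V -> W) (F : V -> clin V W) : open U ->
  (forall x, U x -> is_diff x f (F x)) -> Cn n U F -> Cn n.+1 U f.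
Proof.
move=> oU fF cF; split=> [x /fF[]//|].
by apply: eq_Cn cF => // x /fF/frechet_is_diff.
Qed.

Lemma CnW n V W (U : set V) (f : V -> W) : Cn n.+1 U f -> Cn n U f.
Proof.
elim: n W f => [|n IH] W f [df cf]; last by split=> //; exact: IH.
by move=> x Ux; apply/differentiable_continuous/df.
Qed.

Lemma Cn_cst n V W (U : set V) (w : W) : open U -> Cn n U (fun=> w).
Proof.
move=> oU; elim: n W w => [|n IH] W w; first by move=> x _; exact: cvg_cst.
apply: (@Cn_diff _ _ _ _ _ (fun=> 0)) => // x _; exact: is_diff_cst.
Qed.

Lemma Cn_clin n V W (U : set V) (A : clin V W) : open U -> Cn n U A.
Proof.
move=> oU; case: n => [|n]; first by move=> x _; exact: clin_continuous.
apply: (@Cn_diff _ _ _ _ _ (fun=> A)) => [//|x _|]; first exact: is_diff_clin.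
exact: Cn_cst.
Qed.

Lemma Cn_clin_comp n V W Z (U : set V) (A : clin W Z) (f : V -> W) :
  open U -> Cn n U f -> Cn n U (fun x => A (f x)).
Proof.
move=> oU; elim: n W Z A f => [|n IH] W Z A f.
  move=> cf x Ux; apply: continuous_comp; first exact: cf.
  exact: clin_continuous.
move=> [df cf].
apply: (@Cn_diff _ _ _ _ _ (fun x => clin_postcomp V A (frechet f x))) => //.
  move=> x Ux; apply: is_diff_comp; first exact/is_diff_frechet/df.
  exact: is_diff_clin.
exact: IH.
Qed.

Lemma Cn_pair n V W Z (U : set V) (f : V -> W) (h : V -> Z) :
  open U -> Cn n U f -> Cn n U h -> Cn n U (fun x => (f x, h x)).
Proof.
move=> oU; elim: n W Z f h => [|n IH] W Z f h.
  by move=> cf ch x Ux; apply: cvg_pair; [exact: cf|exact: ch].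
move=> [df cf] [dh ch].
apply: (@Cn_diff _ _ _ _ _
  (fun x => clin_pairing V W Z (frechet f x, frechet h x))) => //.
  move=> x Ux; apply: is_diff_pair; apply: is_diff_frechet; first exact: df.
  exact: dh.
by apply: Cn_clin_comp => //; exact: IH.
Qed.

(** The differential of a bilinear map is a linear function of the base point,
    hence smooth. *)
Lemma Cn_uncurry n V W Z (U : set (V * W)) (B : clin V (clin W Z)) :
  open U -> Cn n U (uncurry B).
Proof.
move=> oU.
have dB : forall p, U p -> is_diff p (uncurry B) (uncurry_diff B p).
  by move=> p _; exact: is_diff_uncurry.
have cB := @Cn_clin n _ _ U (uncurry_diff B) oU.
have H := Cn_diff oU dB cB.
exact: CnW H.
Qed.

(** The differential of h o f at x is the bilinear composition map applied to
    (Dh (f x), Df x). Both components, and the bilinear map after them, fall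
    under the induction hypothesis because it quantifies over all spaces. *)
Lemma Cn_comp n V W Z (U : set V) (U' : set W) (f : V -> W) (h : W -> Z) :
  open U -> open U' -> (forall x, U x -> U' (f x)) ->
  Cn n U f -> Cn n U' h -> Cn n U (h \o f).
Proof.
move=> oU oU' fU.
elim: n V W Z U U' oU oU' f h fU => [|n IH] V W Z U U' oU oU' f h fU.
  by move=> cf ch x Ux; apply: continuous_comp; [exact: cf|exact/ch/fU].
move=> cf ch; have [df cdf] := cf; have [dh cdh] := ch.
pose F x := uncurry (clin_composition V W Z) (frechet h (f x), frechet f x).
apply: (@Cn_diff _ _ _ _ _ F) => //.
  move=> x Ux; apply: is_diff_comp; apply: is_diff_frechet; first exact: df.
  exact/dh/fU.
apply: (IH _ _ _ U setT oU openT (fun x => (frechet h (f x), frechet f x))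
  (uncurry (clin_composition V W Z))) => //.
  apply: Cn_pair => //; apply: (IH _ _ _ U U' oU oU' f (frechet h)) => //.
  exact: CnW.
exact: (Cn_uncurry _ _ openT).
Qed.

End ClassCn.

(** * Symmetry of second derivatives *)

Section SymmetryOfSecondDerivatives.
Context {R : realType}.
Implicit Types V W : normedModType R.

Lemma is_diff_line V (x v : V) (t : R^o) :
  is_diff t (fun s : R^o => s *: v + x) (fun s => s *: v).
Proof.
have -> : (fun s : R^o => s *: v + x) = (fun s : R^o => s *: v) + cst x by [].
apply: (is_diff_eq (is_diffD (is_diff_scalel t v) (is_diff_cst x t))).
by apply/funext => s; rewrite !fctE addr0.
Qed.

Lemma is_derive_line V W (f : V -> W) (x v : V) (t : R) :
  differentiable f (t *: v + x) ->
  is_derive t 1 (fun s => f (s *: v + x)) ('d f (t *: v + x) v).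
Proof.
move=> df; have [dg dgE] := is_diff_comp (is_diff_line x v t) (differentiableP df).
apply: DeriveDef; first exact: diff_derivable.
by rewrite deriveE// dgE/= scale1r.
Qed.

(** By the mean value theorem applied to s |-> f(x + su + tv) - f(x + su), the
    second difference of f along tu and tv is t times the increment of
    y |-> Df(y) u from x + su to x + su + tv for some s in [0, t]. The
    differentiability of that function at x evaluates the increment up to o(t). *)
Lemma second_difference V (f : V -> R^o) (x u v : V) :
  (\forall y \near x, differentiable f y) ->
  differentiable (fun y => 'd f y u : R^o) x ->
  forall e, 0 < e -> \forall t \near (0:R)^'+,
    `|f (t *: u + t *: v + x) - f (t *: u + x) - f (t *: v + x) + f x
      - t ^+ 2 * 'd (fun y => 'd f y u : R^o) x v| <= e * t ^+ 2.
Proof.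
set F : V -> R^o := fun y => 'd f y u; set D : {linear V -> R^o} := 'd F x.
move=> df dF e e0.
(* All points that occur are within t * c of x; each of the two remainders is
   then at most e * t / 2. *)
pose c := `|u| + `|v| + 1; have c0 : 0 < c by rewrite ltr_wpDl// addr_ge0.
have e'0 : 0 < e / (2 * c) by rewrite divr_gt0// mulr_gt0.
have /nbhs_normP[d d0 dP] : \forall h \near (0 : V), differentiable f (h + x) /\
    `|F (h + x) - F x - D h| <= e / (2 * c) * `|h|.
  apply: filterI; last exact: (diff_eps dF e'0).
  move: df; rewrite (near_shift 0 x); apply: filterS => h.
  by rewrite /= subr0.
have {}dP h : `|h| < d -> differentiable f (h + x) /\
    `|F (h + x) - F x - D h| <= e / (2 * c) * `|h|.
  by move=> hd; apply: dP; rewrite /= sub0r normrN.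
near=> t.
have t0 : 0 < t by near: t; exact: nbhs_right_gt.
have tcd : t * c < d.
  rewrite -ltr_pdivlMr//; near: t; apply: nbhs_right_lt; exact: divr_gt0.
have small s r : 0 <= s <= t -> 0 <= r <= t -> `|s *: u + r *: v| <= t * c.
  move=> /andP[s0 st] /andP[r0 rt].
  apply: le_trans (ler_normD _ _) _; rewrite !normrZ !ger0_norm//.
  rewrite /c !mulrDr mulr1 -[leLHS]addr0.
  by apply: lerD; [apply: lerD; exact: ler_wpM2r|exact: ltW].
pose phi s := f (s *: u + (t *: v + x)) - f (s *: u + x).
have near_pts s : 0 <= s <= t ->
    `|s *: u + t *: v| < d /\ `|s *: u| < d.
  move=> st; split; apply: le_lt_trans tcd.
    by apply: small => //; rewrite lexx ltW.
  by rewrite -[s *: u]addr0 -[X in _ + X](scale0r v) small// lexx ltW.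
have dphi s : 0 <= s <= t -> is_derive s 1 phi
    (F (s *: u + (t *: v + x)) - F (s *: u + x)).
  move=> /near_pts[/dP[d1 _] /dP[d2 _]].
  apply: is_deriveB; apply: is_derive_line => //.
  by rewrite addrA.
have [] := @MVT R phi (fun s => F (s *: u + (t *: v + x)) - F (s *: u + x)) 0 t t0.
- by move=> s; rewrite in_itv/= => /andP[s0 st]; apply: dphi; rewrite !ltW.
- apply: derivable_within_continuous => s; rewrite in_itv/= => /dphi[] //.
move=> s; rewrite in_itv/= => /andP[s0 st].
have /near_pts[/dP[_ b1] /dP[_ b2]] : 0 <= s <= t by rewrite !ltW.
rewrite subr0 {1 2}/phi !scale0r !add0r => E.
have bnd r : `|r| <= t * c -> e / (2 * c) * r <= e * t / 2.
  move=> /ler_normlW rtc; apply: le_trans (_ : e / (2 * c) * (t * c) <= _).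
    by rewrite ler_wpM2l// ltW.
  by rewrite le_eqVlt; apply/orP; left; apply/eqP; field; rewrite gt_eqF.
have {}b1 : `|F (s *: u + t *: v + x) - F x - D (s *: u + t *: v)| <= e * t / 2.
  apply: le_trans b1 (bnd _ _); rewrite normr_id; apply: small.
    by rewrite !ltW.
  by rewrite lexx ltW.
have {}b2 : `|F (s *: u + x) - F x - D (s *: u)| <= e * t / 2.
  apply: le_trans b2 (bnd _ _); rewrite normr_id.
  by rewrite -[s *: u]addr0 -[X in _ + X](scale0r v) small ?lexx ?ltW.
have Dl : D (s *: u + t *: v) = D (s *: u) + t * D v.
  by rewrite linearD (linearZ_LR D t v).
rewrite Dl -(addrA (s *: u)) in b1; rewrite -(addrA (t *: u)).
move: b1 b2 E.
move: (f (t *: u + (t *: v + x))) (f (t *: u + x)) (f (t *: v + x)) (f x).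
move: (F (s *: u + (t *: v + x))) (F x) (F (s *: u + x)) (D (s *: u)) (D v).
rewrite /GRing.regular => a1 a0 a2 d1 d2 f1 f2 f3 f0 b1 b2 E.
have -> : f1 - f2 - f3 + f0 - t ^+ 2 * d2 =
    t * ((a1 - a0 - (d1 + t * d2)) - (a2 - a0 - d1)).
  have -> : f0 = (a1 - a2) * t - (f1 - f2 - f3) by rewrite -E; ring.
  by ring.
rewrite normrM gtr0_norm//.
apply: le_trans (_ : t * (e * t / 2 + e * t / 2) <= _).
  apply: ler_wpM2l; first exact: ltW.
  apply: le_trans (ler_normB _ _) _; exact: lerD.
by rewrite le_eqVlt; apply/orP; left; apply/eqP; field.
Unshelve. all: by end_near. Qed.

(** The second difference is symmetric in u and v, and second_difference
    evaluates it for either order. *)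
Lemma schwarz V (f : V -> R^o) (x u v : V) :
  (\forall y \near x, differentiable f y) ->
  differentiable (fun y => 'd f y u : R^o) x ->
  differentiable (fun y => 'd f y v : R^o) x ->
  'd (fun y => 'd f y u : R^o) x v = 'd (fun y => 'd f y v : R^o) x u.
Proof.
move=> df du dv; apply/eqP; rewrite -subr_eq0 -normr_le0.
apply/ler_addgt0Pl => e e0.
have e2 : 0 < e / 2 by rewrite divr_gt0.
have Huv := second_difference v df du e2.
have Hvu := second_difference u df dv e2.
near (0:R)^'+ => t; have t0 : 0 < t by near: t; exact: nbhs_right_gt.
have : `|f (t *: u + t *: v + x) - f (t *: u + x) - f (t *: v + x) + f x
      - t ^+ 2 * 'd (fun y => 'd f y u : R^o) x v| <= e / 2 * t ^+ 2.
  by near: t; exact: Huv.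
have : `|f (t *: v + t *: u + x) - f (t *: v + x) - f (t *: u + x) + f x
      - t ^+ 2 * 'd (fun y => 'd f y v : R^o) x u| <= e / 2 * t ^+ 2.
  by near: t; exact: Hvu.
rewrite (addrC (t *: v)).
move: (f (t *: u + t *: v + x)) (f (t *: u + x)) (f (t *: v + x)) (f x).
set D1 := 'd (fun y => 'd f y u : R^o) x v.
set D2 := 'd (fun y => 'd f y v : R^o) x u.
move: D1 D2; rewrite /GRing.regular => d1 d2 f1 f2 f3 f4 b1 b2.
rewrite addr0 -(ler_pM2l (exprn_gt0 2 t0)).
rewrite -[X in X * _ <= _]gtr0_norm ?exprn_gt0//.
rewrite -normrM.
have -> : t ^+ 2 * (d1 - d2) = (f1 - f3 - f2 + f4 - t ^+ 2 * d2)
   - (f1 - f2 - f3 + f4 - t ^+ 2 * d1) by ring.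
apply: le_trans (ler_normB _ _) _; apply: le_trans (lerD b1 b2) _.
by rewrite le_eqVlt; apply/orP; left; apply/eqP; field.
Unshelve. all: by end_near. Qed.

End SymmetryOfSecondDerivatives.

(** * Smooth maps, tangent vectors and Lagrangian submanifolds *)

Section SmoothMaps.
Context {R : realType}.
Implicit Types V W Z : normedModType R.

Lemma smooth_clin V W (U : set V) (A : clin V W) : open U -> smooth_on U A.
Proof. by move=> oU n; exact: Cn_clin. Qed.

Lemma smooth_cst V W (U : set V) (w : W) : open U -> smooth_on U (fun=> w).
Proof. by move=> oU n; exact: Cn_cst. Qed.

Lemma smooth_clin_comp V W Z (U : set V) (A : clin W Z) (f : V -> W) :
  open U -> smooth_on U f -> smooth_on U (fun x => A (f x)).
Proof. by move=> oU sf n; exact: Cn_clin_comp (sf n). Qed.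

Lemma smooth_pair V W Z (U : set V) (f : V -> W) (h : V -> Z) :
  open U -> smooth_on U f -> smooth_on U h -> smooth_on U (fun x => (f x, h x)).
Proof. by move=> oU sf sh n; exact: Cn_pair. Qed.

Lemma smooth_comp V W Z (U : set V) (U' : set W) (f : V -> W) (h : W -> Z) :
  open U -> open U' -> (forall x, U x -> U' (f x)) ->
  smooth_on U f -> smooth_on U' h -> smooth_on U (fun x => h (f x)).
Proof. by move=> oU oU' fU sf sh n; exact: (Cn_comp oU oU' fU (sf n) (sh n)). Qed.

Lemma smooth_compT V W Z (U : set V) (f : V -> W) (h : W -> Z) :
  open U -> smooth_on U f -> smooth h -> smooth_on U (fun x => h (f x)).
Proof. by move=> oU sf sh; exact: (smooth_comp oU openT _ sf sh). Qed.

Lemma smoothD V W (U : set V) (f h : V -> W) : open U ->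
  smooth_on U f -> smooth_on U h -> smooth_on U (fun x => f x + h x).
Proof.
move=> oU sf sh.
exact: (smooth_clin_comp (clin_fst W W + clin_snd W W) oU (smooth_pair oU sf sh)).
Qed.

Lemma smoothB V W (U : set V) (f h : V -> W) : open U ->
  smooth_on U f -> smooth_on U h -> smooth_on U (fun x => f x - h x).
Proof.
move=> oU sf sh.
exact: (smooth_clin_comp (clin_fst W W - clin_snd W W) oU (smooth_pair oU sf sh)).
Qed.

Lemma smooth_uncurry V W Z (B : clin V (clin W Z)) : smooth (uncurry B).
Proof. by move=> n; apply: Cn_uncurry; exact: openT. Qed.

Lemma smooth_differentiable V W (U : set V) (f : V -> W) x :
  smooth_on U f -> U x -> differentiable f x.
Proof. by move=> /(_ 1%N)[df _]; exact: df. Qed.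

Lemma smooth_frechet V W (U : set V) (f : V -> W) :
  smooth_on U f -> smooth_on U (frechet f).
Proof. by move=> sf n; have [] := sf n.+1. Qed.

Definition clin_scalel V (v : V) : clin R^o V.
Proof.
apply: (@bclin _ _ _ (fun t : R^o => t *: v) `|v|) => [a s t|t].
  by rewrite scalerDl scalerA.
by rewrite normrZ mulrC.
Defined.

Lemma smooth_line V (x v : V) : smooth (fun t : R^o => t *: v + x).
Proof.
apply: smoothD; first exact: openT.
- by apply: (smooth_clin (clin_scalel v)); exact: openT.
- by apply: smooth_cst; exact: openT.
Qed.

(** The tangent vector is the velocity of t |-> f(x + tv). *)
Lemma tangent_range V W (f : V -> W) x v : smooth f ->
  tangent (range f) (f x) ('d f x v).
Proof.
move=> sf; exists setT, (fun t : R^o => f (t *: v + x)).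
have x0 : (0 : R) *: v + x = x by rewrite scale0r add0r.
have df : differentiable f ((0 : R) *: v + x).
  exact: (smooth_differentiable sf).
have [dg dgE] := is_diff_comp (is_diff_line x v (0 : R)) (differentiableP df).
split; [exact: openT|by []| | |].
- exact: (smooth_compT openT (smooth_line x v) sf).
- by move=> t _; exists (t *: v + x).
- by split; [rewrite x0|rewrite dgE/= scale1r x0].
Qed.

Lemma tangent_linear W (S : set W) p v :
  (forall t : R, S (t *: v + p)) -> tangent S p v.
Proof.
move=> Sl; exists setT, (fun t : R^o => t *: v + p).
have [dg dgE] := is_diff_line p v (0 : R).
split; [exact: openT|by []|exact: smooth_line|by []|].
by rewrite scale0r add0r dgE scale1r.
Qed.

Lemma tangent_clin W Z (A : clin W Z) (S : set W) p v :
  tangent S p v -> tangent (A @` S) (A p) (A v).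
Proof.
move=> [U [gamma [opU U0 sg gS [g0 dg]]]].
exists U, (fun t => A (gamma t)).
split=> //; first exact: smooth_clin_comp.
  by move=> t Ut; exists (gamma t) => //; exact: gS.
split; first by rewrite g0.
have [_ dgE] := is_diff_comp (differentiableP (smooth_differentiable sg U0))
  (is_diff_clin A (gamma 0)).
by rewrite dgE/= dg.
Qed.

(** A linear symplectic isomorphism preserves Lagrangian submanifolds: it
    carries slice charts to slice charts and tangent vectors to tangent
    vectors. *)
Lemma lagrangian_transport W Z (A : clin W Z) (B : clin Z W)
    (omega : W -> W -> R^o) (omega' : Z -> Z -> R^o) (S : set W) :
  cancel A B -> cancel B A -> (forall u v, omega' (A u) (A v) = omega u v) ->
  lagrangian omega S -> lagrangian omega' (A @` S).
Proof.
move=> AB BA AO [subS lagS].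
have tAS p v : tangent (A @` S) (A p) v <-> tangent S p (B v).
  split=> [/(tangent_clin B)|/(tangent_clin A)]; last by rewrite BA.
  rewrite AB image_comp.
  by rewrite (_ : B \o A = id) ?image_id//; apply/funext.
split=> [_ [p Sp <-]|_ [p Sp <-]].
  have [F1 [F2 [U [U' [Phi [Psi [[opU Up opU'] PhiK PsiK [sPhi sPsi] SPhi]]]]]]] :=
    subS p Sp.
  have opBU : open (B @^-1` U).
    by apply: open_comp => // z _; exact: clin_continuous.
  exists F1, F2, (B @^-1` U), U', (fun z => Phi (B z)), (fun q => A (Psi q)).
  split.
  - by split=> //=; rewrite AB.
  - by move=> w /PhiK[? PK]; split=> //; rewrite PK BA.
  - by move=> q /PsiK[? PK]; rewrite /= AB.
  - split; last exact: smooth_clin_comp.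
    by apply: (smooth_comp opBU opU _ _ sPhi) => //; exact: smooth_clin.
  - move=> w /SPhi <-; split=> [[w' Sw' <-]|Sw]; first by rewrite AB.
    by exists (B w).
apply/seteqP; split=> v /=.
  move=> /tAS tv u /tAS tu; rewrite -(BA v) -(BA u) AO.
  by move: tv; rewrite lagS//; apply.
move=> vu; apply/tAS; rewrite lagS// => u tu.
by rewrite -AO BA; apply: vu; apply/tAS; rewrite AB.
Qed.

Lemma diff0_cst V (f : V -> R^o) : (forall x, is_diff x f 0) ->
  forall x y, f x = f y.
Proof.
move=> df x y.
pose g (s : R) : R := f (s *: (x - y) + y).
have dg (s : R) : is_derive s 1 g 0.
  have [d d0] := df (s *: (x - y) + y).
  by have := is_derive_line d; rewrite d0.
have [] := @MVT_segment R g (fun=> 0) 0 1 ler01.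
  by apply: derivable_within_continuous => s s01; have [] := dg s.
move=> c _; rewrite mul0r => /subr0_eq.
by rewrite /g scale1r scale0r add0r subrK.
Qed.

(** Schwarz's theorem, with the derivative taken in the operator norm. *)
Lemma second_diff_sym V (f : V -> R^o) x u v :
  (\forall y \near x, differentiable f y) -> differentiable (frechet f) x ->
  frechet (frechet f) x u v = frechet (frechet f) x v u.
Proof.
move=> df dff.
have ev w : is_diff x (fun y => 'd f y w : R^o)
    (fun h => frechet (frechet f) x h w).
  have := is_diff_comp (is_diff_frechet dff)
    (is_diff_clin (clin_flip (clin_id (clin V R^o)) w) (frechet f x)).
  apply: near_is_diff; apply: filterS df => y dfy.
  exact: (congr1 (fun h => h w) (frechetE dfy)).
have [du dux] := ev u; have [dv dvx] := ev v.
have := schwarz df du dv; rewrite dux dvx => E; exact: (esym E).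
Qed.

(** What is needed of g to deduce identities between its vectors from
    identities between real numbers. *)
Definition dual_separates V :=
  forall x y : V, (forall mu : dual_space V, mu x = mu y) -> x = y.

Lemma reflexive_separates V : reflexive_space V -> dual_separates V.
Proof.
move=> [j [jK _]] x y xy; apply: (can_inj jK); apply: clin_eqP => mu.
by rewrite !bidual_mapE.
Qed.

(** The real case, applied to all the functions mu o f. *)
Lemma second_diff_sym_sep V W (f : V -> W) x u v : dual_separates W ->
  (\forall y \near x, differentiable f y) -> differentiable (frechet f) x ->
  frechet (frechet f) x u v = frechet (frechet f) x v u.
Proof.
move=> sepW df dff; apply: sepW => mu.
have dmu y : differentiable f y ->
    is_diff y (fun z => mu (f z)) (clin_comp mu (frechet f y)).
  by move=> dfy; apply: is_diff_comp (is_diff_frechet dfy) (is_diff_clin mu _).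
have dmuf : is_diff x (frechet (fun z => mu (f z)))
    (clin_comp (clin_postcomp V mu) (frechet (frechet f) x)).
  have := is_diff_comp (is_diff_frechet dff)
    (is_diff_clin (clin_postcomp V mu) (frechet f x)).
  apply: near_is_diff; apply: filterS df => y dfy.
  exact/esym/frechet_is_diff/dmu.
have dmun : \forall y \near x, differentiable (fun z => mu (f z)) y.
  by apply: filterS df => y /dmu[].
have [dmufx _] := dmuf.
by have := second_diff_sym u v dmun dmufx; rewrite (frechet_is_diff dmuf).
Qed.

End SmoothMaps.

(** * The graph of dl *)

Section Legendre.
Context {R : realType} (g : completeNormedModType R).
Context (l : g -> R^o) (l_smooth : smooth l).

Let dl := frechet l.
Let dl_smooth : smooth dl.
Proof. exact: smooth_frechet. Qed.

Let dl_diff xi : is_diff xi dl (frechet dl xi).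
Proof. by apply: is_diff_frechet; exact: (smooth_differentiable dl_smooth). Qed.

(** A curve in the graph of dl is determined by its second component, so its
    velocity lies in the graph of the second derivative of l. *)
Lemma tangent_s_Tgstar xi :
  tangent (s_Tgstar l) (dl xi, xi) = range (fun v => (frechet dl xi v, v)).
Proof.
apply/seteqP; split=> [w|_ [v _ <-]].
  move=> [U [gamma [opU U0 sg gS [g0 dg]]]].
  have [g10 g20] : (gamma 0).1 = dl xi /\ (gamma 0).2 = xi by rewrite g0.
  have dgamma := differentiableP (smooth_differentiable sg U0).
  have d1 := is_diff_comp dgamma (is_diff_clin (clin_fst _ _) (gamma 0)).
  have d2 := is_diff_comp dgamma (is_diff_clin (clin_snd _ _) (gamma 0)).
  have dl0 : is_diff ((gamma 0).2) dl (frechet dl xi) by rewrite g20.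
  have d3 := is_diff_comp d2 dl0.
  have E : {near (0 : R^o), dl \o (clin_snd _ _ \o gamma) =1
      clin_fst _ _ \o gamma}.
    apply: open_near_eq opU U0 _ => t /gS [v _ vE].
    change (dl (gamma t).2 = (gamma t).1).
    rewrite -vE.
    reflexivity.
  have [_ d1E] := d1; have [_] := near_is_diff E d3.
  rewrite d1E => /(congr1 (fun h => h 1)) /=; rewrite dg => wE.
  by exists w.2 => //; rewrite -wE -surjective_pairing.
have sf : smooth (fun xi => (dl xi, xi)).
  apply: smooth_pair => //; first exact: openT.
  exact: (smooth_clin (clin_id g) openT).
have := tangent_range xi v sf.
have [_ ->] := is_diff_pair (dl_diff xi) (is_diff_id xi).
by [].
Qed.

(** The graph is straightened by (mu, xi) |-> (xi, mu - dl xi). *)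
Lemma submanifold_s_Tgstar : submanifold (s_Tgstar l).
Proof.
move=> _ [xi _ <-].
exists g, (dual_space g : normedModType R), setT, setT,
  (fun p : dual_space g * g => (p.2, p.1 - dl p.2)),
  (fun q : g * dual_space g => (q.2 + dl q.1, q.1)).
have sfst (V W : normedModType R) : smooth (fst : V * W -> V).
  exact: (smooth_clin (clin_fst V W) openT).
have ssnd (V W : normedModType R) : smooth (snd : V * W -> W).
  exact: (smooth_clin (clin_snd V W) openT).
split.
- by split=> //; exact: openT.
- by move=> [mu x] _ /=; rewrite subrK.
- by move=> [x nu] _ /=; rewrite addrK.
- split; apply: smooth_pair; rewrite ?openT//; [exact: openT| | |exact: openT| |].
  + exact: ssnd.
  + apply: smoothB; [exact: openT|exact: sfst|].
    exact: (smooth_compT openT (ssnd _ _) dl_smooth).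
  + apply: smoothD; [exact: openT|exact: ssnd|].
    exact: (smooth_compT openT (sfst _ _) dl_smooth).
  + exact: sfst.
- move=> [mu x] _ /=; split=> [[y _ [<- <-]]|/subr0_eq->].
    by rewrite subrr.
  by exists x.
Qed.

(** The tangent space is the graph of the second derivative A of l. It is
    isotropic because A is symmetric; it is its own orthogonal because
    nu(u) = A(u)(v) for all u forces nu = A(v). *)
Lemma lagrangian_s_Tgstar : lagrangian (@canonical_Tgstar R g) (s_Tgstar l).
Proof.
split; first exact: submanifold_s_Tgstar.
move=> _ [xi _ <-]; rewrite tangent_s_Tgstar.
have sym u v : frechet dl xi u v = frechet dl xi v u.
  apply: second_diff_sym.
    by apply: nearW => y; exact: (smooth_differentiable l_smooth).
  exact: (smooth_differentiable dl_smooth).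
apply/seteqP; split=> [_ [v _ <-] _ [u _ <-]|[nu v] H].
  by rewrite /canonical_Tgstar/= sym subrr.
exists v => //=; congr (_, _); apply: clin_eqP => u.
have := H _ (imageT _ u); rewrite /canonical_Tgstar/= => /subr0_eq ->.
exact: sym.
Qed.

End Legendre.

(** * The Lie bracket *)

Section LieBracket.
Context {R : realType} (G : groupType) (g : completeNormedModType R).
Context (L : lie_group G g) (g_sep : dual_separates g).

Let phi : G -> g := cmap (chart1 L).
Let psi : g -> G := cinv (chart1 L).
Let e : g := phi 1%g.

Let phiK x : cdom (chart1 L) x -> psi (phi x) = x.
Proof. exact: (atlas_inv (atlasP L) (chart1_atlas L)). Qed.

Let psiK x : cimg (chart1 L) x -> phi (psi x) = x.
Proof. by move=> [y dy <-]; rewrite -/phi phiK. Qed.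

Let psi_e : psi e = 1%g.
Proof. exact/phiK/chart1_id. Qed.

(** The product and the inversion, read in the chart around the identity. *)
Let m (p : g * g) : g := phi (psi p.1 * psi p.2)%g.
Let i (x : g) : g := phi (psi x)^-1%g.

Let mulP : exists U : set (g * g), [/\ open U, U (e, e),
  (forall p, U p -> [/\ psi (m p) = (psi p.1 * psi p.2)%g,
      phi (psi p.1) = p.1, phi (psi p.2) = p.2 & differentiable m p]) &
  differentiable (frechet m) (e, e)].
Proof.
have c1 := chart1_id L.
have c11 : cdom (chart1 L) (1 * 1)%g by rewrite mulg1.
have [U [oU Ue UP sU]] := mul_smooth (chart1_atlas L) (chart1_atlas L)
  (chart1_atlas L) c1 c1 c11.
exists U; split=> //.
  move=> p Up; have [i1 i2 im] := UP _ Up.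
  split; [exact: phiK|exact: psiK|exact: psiK|].
  exact: (smooth_differentiable sU).
exact: (smooth_differentiable (smooth_frechet sU)).
Qed.

Let invP : exists U : set g, [/\ open U, U e &
  forall x, U x -> psi (i x) = (psi x)^-1%g /\ differentiable i x].
Proof.
have c1 := chart1_id L.
have c11 : cdom (chart1 L) (1^-1)%g by rewrite invg1.
have [U [oU Ue UP sU]] := inv_smooth (chart1_atlas L) (chart1_atlas L) c1 c11.
exists U; split=> // x Ux; have [_ im] := UP _ Ux; split; first exact: phiK.
exact: (smooth_differentiable sU).
Qed.

Let i_e : i e = e.
Proof. by rewrite /i psi_e invg1. Qed.

Let inl : clin g (g * g)%type := clin_pair (clin_id g) 0.
Let inr : clin g (g * g)%type := clin_pair 0 (clin_id g).

Let D2m := frechet (frechet m) (e, e).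

Let is_diff_inl (a x : g) : is_diff x (fun y => (y, a)) inl.
Proof. exact: (is_diff_pair (is_diff_id x) (is_diff_cst a x)). Qed.

Let is_diff_inr (a x : g) : is_diff x (fun y => (a, y)) inr.
Proof. exact: (is_diff_pair (is_diff_cst a x) (is_diff_id x)). Qed.

Let near_preimage (V W : normedModType R) (f : V -> W) (df : V -> W) x
    (U : set W) : is_diff x f df -> open U -> U (f x) ->
  \forall y \near x, U (f y).
Proof.
move=> [dfx _] oU Ux; apply: (differentiable_continuous dfx).
exact: open_nbhs_nbhs.
Qed.

Let is_diff_unique (V W : normedModType R) (f df df' : V -> W) x :
  is_diff x f df -> is_diff x f df' -> df = df'.
Proof. by move=> [_ <-] [_ <-]. Qed.

(** The unit law: m(e, x) = x for x near e, hence D_2 m(e, x) = id. *)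
Let dm_r : \forall x \near e, m (e, x) = x /\
  forall v, frechet m (e, x) (inr v) = v.
Proof.
have [U [oU Ue UP _]] := mulP.
have mE : \forall x \near e, m (e, x) = x.
  apply: filterS (near_preimage (is_diff_inr e e) oU Ue) => x /UP[_ _ + _].
  by rewrite /m /= psi_e mul1g.
have dm : \forall x \near e, differentiable m (e, x).
  by apply: filterS (near_preimage (is_diff_inr e e) oU Ue) => x /UP[].
have {}mE : \forall x \near e, {near x, (fun y => m (e, y)) =1 id}.
  exact: near_join mE.
apply: filterS2 mE dm => x mE dm; split; first exact: (nbhs_singleton mE).
have := is_diff_comp (is_diff_inr e x) (is_diff_frechet dm).
move=> /(near_is_diff mE) /is_diff_unique /(_ (is_diff_id x)) E v.
exact: (congr1 (fun h => h v) E).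
Qed.

Let dm_l v : frechet m (e, e) (inl v) = v.
Proof.
have [U [oU Ue UP _]] := mulP; have [_ _ _ dm] := UP _ Ue.
have mE : {near e, (fun y => m (y, e)) =1 id}.
  apply: filterS (near_preimage (is_diff_inl e e) oU Ue) => x /UP[_ + _ _].
  by rewrite /m /= psi_e mulg1.
have := is_diff_comp (is_diff_inl e e) (is_diff_frechet dm).
move=> /(near_is_diff mE) /is_diff_unique /(_ (is_diff_id e)) E.
exact: (congr1 (fun h => h v) E).
Qed.

Let inlDinr u v : inl u + inr v = (u, v).
Proof. by rewrite /inl /inr !clin_pairE; congr (_, _); rewrite /= ?addr0 ?add0r. Qed.

Let dm_e u v : frechet m (e, e) (u, v) = u + v.
Proof.
rewrite -(inlDinr u v) linearD; congr (_ + _).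
  exact: dm_l.
exact: (nbhs_singleton dm_r).2.
Qed.

Let dm_ee : is_diff (e, e) m (frechet m (e, e)).
Proof.
by have [U [_ Ue UP _]] := mulP; have [_ _ _ /is_diff_frechet] := UP _ Ue.
Qed.

Let d2m_ee : is_diff (e, e) (frechet m) D2m.
Proof. by have [U [_ _ _ /is_diff_frechet]] := mulP. Qed.

(** Differentiating m(x, i(x)) = e at x = e. *)
Let di : is_diff e i (- clin_id g).
Proof.
have [U [oU Ue UP]] := invP.
have die := is_diff_frechet (UP _ Ue).2.
suff -> : - clin_id g = frechet i e by [].
have d1 := is_diff_pair (is_diff_id e) die.
have d2 : is_diff (e, i e) m (frechet m (e, e)).
  by rewrite i_e; exact: dm_ee.
have mE : {near e, m \o (fun x => (x, i x)) =1 cst e}.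
  apply: (open_near_eq oU Ue) => x /UP[ix _].
  by rewrite /m/= ix mulgV.
apply: clin_eqP => v.
have := is_diff_unique (near_is_diff mE (is_diff_comp d1 d2)) (is_diff_cst e e).
move=> /(congr1 (fun h => h v)); rewrite /= dm_e => /eqP.
by rewrite addr_eq0 => /eqP E; rewrite -[LHS]/(- v) {1}E opprK.
Qed.

(** D_2 m(e, x) is constant for x near e. *)
Let D2m_r u v : D2m (inr u) (inr v) = 0.
Proof.
have d1 := is_diff_comp (is_diff_inr e e) d2m_ee.
have d2 := is_diff_comp d1 (is_diff_clin (clin_flip (clin_id _) (inr v)) _).
have E : {near e, clin_flip (clin_id _) (inr v) \o
    (frechet m \o (fun x => (e, x))) =1 cst v}.
  by apply: filterS dm_r => x [_ xE]; exact: xE.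
have := is_diff_unique (near_is_diff E d2) (is_diff_cst v e).
by move=> /(congr1 (fun h => h u)).
Qed.

(** Near e, conjugation by psi x is y |-> m(i(x), m(y, x)). *)
Let Ad_near : \forall x \near e, forall eta,
  Ad L (psi x) eta = frechet m (i x, x) (inr (frechet m (e, x) (inl eta))).
Proof.
have [U [oU Ue UP _]] := mulP; have [U' [oU' U'e U'P]] := invP.
have Uix : \forall x \near e, U (i x, x).
  apply: (near_preimage (is_diff_pair di (is_diff_id e)) oU).
  by rewrite i_e.
have Uex := near_preimage (is_diff_inr e e) oU Ue.
have U'x : \forall x \near e, U' x := open_nbhs_nbhs (conj oU' U'e).
apply: filterS2 (filterI Uix Uex) (filterI U'x dm_r).
move=> x [Uixx Uexx] [/U'P[ix _] [mex _]] eta.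
have [_ _ _ dmex] := UP _ Uexx; have [_ _ _ dmix] := UP _ Uixx.
have d1 := is_diff_comp (is_diff_inl x e) (is_diff_frechet dmex).
have d2 := is_diff_comp d1 (is_diff_inr (i x) (m (e, x))).
have dmix' : is_diff (i x, m (e, x)) m (frechet m (i x, x)).
  by rewrite mex; exact: is_diff_frechet.
have d3 := is_diff_comp d2 dmix'.
rewrite /Ad -/phi -/psi -/e.
have E : {near e, m \o ((fun z => (i x, z)) \o (m \o (fun y => (y, x)))) =1
    (fun y => phi (conjugation (psi x) (psi y)))}.
  apply: filterS (near_preimage (is_diff_inl x e) oU Uexx) => y /UP[yx _ _ _].
  rewrite /= [m (i x, _)]/m /= ix yx /conjugation.
  by rewrite mulgA.
by have [_ ->] := near_is_diff E d3.
Qed.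

(** The mixed second derivative B of the product at the identity, with B(u, v)
    taken along u in the first factor and v in the second, antisymmetrized:
    eta |-> B(eta, xi) - B(xi, eta). In both terms the derivative along xi is
    taken last. *)
Definition bracket_clin (xi : g) : clin g g :=
  clin_comp (D2m (inr xi)) inl - clin_comp (D2m (inl xi)) inr.

(** Ad (psi x) eta = Dm(i(x), x) (0, Dm(e, x) (eta, 0)) is differentiated at
    x = e in the direction xi. The direction of (i(x), x) is (- xi, xi), which
    contributes - B(xi, eta); the inner factor contributes B(eta, xi). *)
Lemma bracketE xi eta : bracket L xi eta = bracket_clin xi eta.
Proof.
rewrite /bracket -/phi -/psi -/e.
have d1 := is_diff_pair di (is_diff_id e).
have d2m' : is_diff (i e, e) (frechet m) D2m.
  by rewrite i_e; exact: d2m_ee.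
have d2 := is_diff_comp d1 d2m'.
have d3 := is_diff_comp (is_diff_inr e e) d2m_ee.
have d4 := is_diff_comp d3 (is_diff_clin (clin_flip (clin_id _) (inl eta)) _).
have d5 := is_diff_comp d4 (is_diff_clin inr _).
have d6 := is_diff_comp (is_diff_pair d2 d5)
  (is_diff_uncurry (clin_id (clin (g * g)%type g)) _).
have E : {near e, uncurry (clin_id _) \o (fun x => (frechet m (i x, x),
      inr (frechet m (e, x) (inl eta)))) =1 (fun x => Ad L (psi x) eta)}.
  by apply: filterS Ad_near => x xE; exact: esym (xE eta).
have [_ ->] := near_is_diff E d6.
transitivity (frechet m (i e, e) (inr (D2m (inr xi) (inl eta))) +
  D2m (- xi, xi) (inr (frechet m (e, e) (inl eta)))); first by [].
have dN : D2m (inl (- xi)) = - D2m (inl xi).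
  transitivity (D2m (- inl xi)); last exact: linearN.
  by congr (D2m _); exact: linearN.
have dB : D2m (- xi, xi) = D2m (inr xi) - D2m (inl xi).
  by rewrite -(inlDinr (- xi) xi) -dN addrC; exact: linearD.
rewrite i_e dm_l (nbhs_singleton dm_r).2 dB clinD D2m_r add0r.
by [].
Qed.

(** Exchanging xi and eta in B(eta, xi) - B(xi, eta) changes the sign and the
    order of differentiation; the order is immaterial by Schwarz's theorem. *)
Lemma bracket_antisym xi eta : bracket L xi eta = - bracket L eta xi.
Proof.
have [U [oU Ue UP d2m]] := mulP.
have sym u v : D2m u v = D2m v u.
  apply: second_diff_sym_sep g_sep _ d2m.
  by apply: filterS (open_nbhs_nbhs (conj oU Ue)) => y /UP[].
rewrite !bracketE.
transitivity (D2m (inr xi) (inl eta) - D2m (inl xi) (inr eta)); first by [].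
by rewrite sym (sym (inl xi)) -opprB.
Qed.

(** mkclin in the definition of ad_star does not fall back on its default
    value, since the bracket is bounded in its second argument. *)
Lemma ad_starE xi mu eta : ad_star L xi mu eta = mu (bracket L xi eta).
Proof.
have E : (fun eta => mu (bracket L xi eta)) = clin_comp mu (bracket_clin xi).
  by apply/funext => h; rewrite bracketE.
rewrite /ad_star E mkclinE ?bracketE//; last exact: clin_continuous.
exact: clin_linear.
Qed.

End LieBracket.

(** * The Morse family *)

Section Generation.
Context {R : realType} (g : completeNormedModType R).
Implicit Types l : g -> R^o.
Local Notation P := (g * dual_space g)%type.

Definition Delta_bilinear : clin g (clin (dual_space g) R^o) :=
  clin_flip (clin_id (dual_space g)).

Definition dDelta : clin P (clin P R^o) := uncurry_diff Delta_bilinear.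

Lemma dDeltaE p v : dDelta p v = v.2 p.1 + p.2 v.1.
Proof. by []. Qed.

Lemma is_diff_Delta p : is_diff p (@Delta R g) (dDelta p).
Proof. exact: (is_diff_uncurry Delta_bilinear p). Qed.

Definition clin_precomp (V W Z : normedModType R) (A : clin V W) :
  clin (clin W Z) (clin V Z) := clin_flip (clin_composition V W Z) A.

Definition dE l (p : P) : clin P R^o :=
  clin_precomp _ (clin_fst g (dual_space g)) (frechet l p.1) - dDelta p.

Lemma dEE l p v : dE l p v = frechet l p.1 v.1 - (v.2 p.1 + p.2 v.1).
Proof. by []. Qed.

Lemma is_diff_E l : smooth l -> forall p, is_diff p (E_lh l) (dE l p).
Proof.
move=> sl p.
have dl := is_diff_frechet (smooth_differentiable sl (I : setT p.1)).
have d1 := is_diff_comp (is_diff_clin (clin_fst g (dual_space g)) p) dl.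
exact: (is_diffB d1 (is_diff_Delta p)).
Qed.

Lemma smooth_E l : smooth l -> smooth (E_lh l).
Proof.
move=> sl; apply: smoothB; first exact: openT.
  exact: (smooth_compT openT (smooth_clin (clin_fst _ _) openT) sl).
exact: (smooth_uncurry Delta_bilinear).
Qed.

Lemma frechet_E l : smooth l -> frechet (E_lh l) = dE l.
Proof. by move=> sl; apply/funext => p; exact/frechet_is_diff/is_diff_E. Qed.

Lemma diff_snd (V W : normedModType R) (p : V * W) :
  'd (snd : V * W -> W) p = snd :> (V * W -> W).
Proof. by have [_] := is_diff_clin (clin_snd V W) p. Qed.

(** Transversality: V^0 is a linear subspace, the covectors with no component
    along g. The tangent space of im(dE) contains the images of the vectors
    (0, mu'), and the second derivative of E in that direction has g-component
    - mu'. Hence mu' may be chosen so as to absorb the g-component of any given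
    alpha. *)
Lemma morse_family_E l : smooth l ->
  morse_family (snd : P -> dual_space g) (E_lh l).
Proof.
move=> sl; split; first exact: smooth_E.
move=> z [[p _ <-] HV] [w1 alpha].
pose mu' : dual_space g := - clin_comp alpha (clin_pair (clin_id g) 0).
pose u1 : P := (0, mu').
have sdl : smooth (dE l) by rewrite -frechet_E//; exact/smooth_frechet/smooth_E.
have graph_smooth : smooth (fun q : P => (q, dE l q)).
  apply: smooth_pair => //; first exact: openT.
  exact: (smooth_clin (clin_id P) openT).
have d2l := is_diff_frechet
  (smooth_differentiable (smooth_frechet sl) (I : setT p.1)).
have d1 := is_diff_comp (is_diff_clin (clin_fst g (dual_space g)) p) d2l.
have d2 := is_diff_comp d1
  (is_diff_clin (clin_precomp R^o (clin_fst g (dual_space g))) (frechet l p.1)).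
have d3 : is_diff p (dE l) _ := is_diffB d2 (is_diff_clin dDelta p).
have [_ d4] := is_diff_pair (is_diff_id p) d3.
exists ('d (fun q : P => (q, dE l q)) p u1),
  ((w1, alpha) - 'd (fun q : P => (q, dE l q)) p u1).
split; last by rewrite addrC subrK.
  have := tangent_range p u1 graph_smooth.
  by rewrite /im_d frechet_E.
apply: tangent_linear => t v; rewrite /vertical diff_snd/= => v2.
pose q : clin P R^o :=
  alpha - ('d (fun q : P => (q, dE l q)) p u1).2.
have q2 : q v = 0.
  have -> : q v = alpha v - (frechet (frechet l) p.1 0 v.1 - (v.2 0 + mu' v.1)).
    by rewrite /q d4.
  have -> : frechet (frechet l) p.1 0 v.1 = 0 by rewrite linear0.
  rewrite linear0 add0r sub0r opprK.
  transitivity (alpha v - alpha (v.1, 0)); first by [].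
  by rewrite -v2 -surjective_pairing subrr.
transitivity (t * q v + frechet (E_lh l) p v); first by [].
rewrite q2 mulr0 add0r; apply: HV.
by rewrite /vertical diff_snd.
Qed.

(** E is critical along the fibre over mu exactly at the xi with mu = dl xi,
    and its derivative in mu is - xi. *)
Lemma generatedE l : smooth l ->
  generated (snd : P -> dual_space g) (E_lh l) = (@covector R g) @` s_Tgstar l.
Proof.
move=> sl; apply/seteqP; split=> [[mu alpha]|_ [_ [xi _ <-] <-]].
  move=> [[xi mu'] /= -> H].
  have {}H v : alpha v.2 = frechet l xi v.1 - (v.2 xi + mu v.1).
    have := H v; rewrite diff_snd => ->.
    by have [_ ->] := is_diff_E sl (xi, mu).
  exists (frechet l xi, xi); first by exists xi.
  rewrite /covector/=; congr (_, _); apply: clin_eqP => v.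
    have := H (v, 0); rewrite /= linear0 add0r => E; exact: (subr0_eq (esym E)).
  have := H (0, v); rewrite /= !linear0 addr0 sub0r => ->.
  by rewrite -[LHS]/(- bidual_map xi v) bidual_mapE.
exists (xi, frechet l xi) => // v; rewrite diff_snd.
have [_ ->] := is_diff_E sl (xi, frechet l xi).
rewrite dEE/= opprD addrCA subrr addr0.
by rewrite -[LHS]/(- bidual_map xi v.2) bidual_mapE.
Qed.

(** Reflexivity makes covector an isomorphism of T^*-models, with inverse
    (mu, alpha) |-> (mu, - j alpha). *)
Lemma lagrangian_generated l : reflexive_space g -> smooth l ->
  lagrangian (@canonical_form R (dual_space g))
    ((@covector R g) @` s_Tgstar l).
Proof.
move=> [j [jK Kj]] sl.
pose bid : clin g (dual_space (dual_space g)) := Delta_bilinear.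
have bidE x : bidual_map x = bid x.
  by apply: clin_eqP => mu; rewrite bidual_mapE.
pose C := clin_pair (clin_fst (dual_space g) g)
  (- clin_comp bid (clin_snd (dual_space g) g)).
have CE : @covector R g = C by apply/funext => p; rewrite /covector bidE.
pose B := clin_pair (clin_fst (dual_space g) (dual_space (dual_space g)))
  (- clin_comp j (clin_snd (dual_space g) (dual_space (dual_space g)))).
have jN y : - j (- y) = j y by rewrite linearN opprK.
have bidN y : - bid (- y) = bid y by rewrite linearN opprK.
rewrite CE; apply: (@lagrangian_transport R _ _ C B).
- move=> [mu x]; rewrite /B clin_pairE; congr (_, _).
  transitivity (- j (- bid x)); first by [].
  by rewrite jN -bidE jK.
- move=> [mu x]; rewrite /C clin_pairE; congr (_, _).
  transitivity (- bid (- j x)); first by [].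
  by rewrite bidN -bidE Kj.
- by move=> u v; rewrite -CE covector_symplectic.
exact: lagrangian_s_Tgstar.
Qed.

End Generation.

(** * The potential difference *)

Section Potential.
Context {R : realType} (G : groupType) (g : completeNormedModType R).
Context (L : lie_group G g) (lambda : dual_space g).
Context (g_sep : dual_separates g).

(** Along X_(0, ups, zeta) the equation says that D and Delta have the same
    differential at every point of g * g^*, so their difference is constant.
    Conversely, chi2 - chi1 = <mu, zeta> + <ups, xi>, while dDelta evaluates on
    X_(eta, ups, zeta) to <mu, zeta> + <ups, xi> + <mu, [xi, eta]> +
    <mu, [eta, xi]>; the last two terms cancel by antisymmetry. *)
Lemma potential_differenceP (D : g * dual_space g -> R^o) :
  potential_difference L lambda D <-> exists c, forall p, D p = Delta p + c.
Proof.
have diff_pull (D' : g * dual_space g -> R^o)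
    (z : dual_space g * dual_space g * g) (A : g * dual_space g -> R^o) :
    is_diff (z.2, z.1.2) D' A ->
    is_diff z (fun q => D' (tau_zd q, pi_zd q)) (fun v => A (v.2, v.1.2)).
  have d1 := is_diff_clin (clin_snd (dual_space g * dual_space g)%type g) z.
  have d2 := is_diff_clin (clin_comp (clin_snd (dual_space g) (dual_space g))
    (clin_fst (dual_space g * dual_space g)%type g)) z.
  exact: (is_diff_comp (is_diff_pair d1 d2)).
split=> [[sD HD]|[c Dc]].
  have dD p : is_diff p D (dDelta g p).
    have dDp := is_diff_frechet (smooth_differentiable sD (I : setT p)).
    suff -> : dDelta g p = frechet D p by [].
    apply: clin_eqP => -[zeta ups]; rewrite dDeltaE.
    (* Any point of the orbit serves as first component. *)
    pose z : dual_space g * dual_space g * g :=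
      (Ad_star L 1^-1%g lambda, p.2, p.1).
    have zz : zd L lambda z by exists 1%g.
    have := HD z zz 0 ups zeta.
    have dDz : is_diff (p.1, p.2) D (frechet D p).
      by rewrite -surjective_pairing.
    have [_ ->] := diff_pull D z _ dDz.
    have b0 xi : bracket L xi 0 = 0 by rewrite bracketE linear0.
    have a0 mu : ad_star L 0 mu = 0.
      apply: clin_eqP => eta.
      by rewrite ad_starE bracket_antisym// b0 oppr0 linear0.
    rewrite /X_field/= a0 b0 !addr0 => <-.
    rewrite /chi1 /chi2/= /tau_zd/pi_zd/=.
    by rewrite opprB [RHS]addrC addrA subrK.
  have d0 p : is_diff p (D - @Delta R g) 0.
    have := is_diffB (dD p) (is_diff_Delta p).
    by rewrite subrr.
  exists ((D - @Delta R g) 0) => p.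
  rewrite -(diff0_cst d0 p 0).
  by rewrite -[X in _ = _ + X]/(D p - Delta p) addrC subrK.
have DE : D = (@Delta R g) + cst c by apply/funext.
split.
  rewrite DE; apply: smoothD; first exact: openT.
    exact: (smooth_uncurry (Delta_bilinear g)).
  exact: (smooth_cst _ openT).
move=> z zz eta ups zeta.
have dD : is_diff (z.2, z.1.2) D (dDelta g (z.2, z.1.2)).
  rewrite DE; have := is_diffD (is_diff_Delta (z.2, z.1.2))
    (is_diff_cst c (z.2, z.1.2)).
  by rewrite addr0.
have [_ ->] := diff_pull _ _ _ dD.
transitivity ((ups + ad_star L eta z.1.2) z.2 + z.1.2 (zeta + bracket L z.2 eta));
  last by [].
have -> : z.1.2 (zeta + bracket L z.2 eta) =
    z.1.2 zeta - z.1.2 (bracket L eta z.2) :> R.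
  by rewrite linearD bracket_antisym// linearN.
rewrite clinD ad_starE.
change (lambda eta + z.1.2 zeta - (lambda eta - ups z.2) =
  ups z.2 + z.1.2 (bracket L eta z.2)
  + (z.1.2 zeta - z.1.2 (bracket L eta z.2)) :> R).
by ring.
Qed.
End Potential.

(** * Generation of the Euler-Poincare dynamics *)

Theorem mainTheorem7 (R : realType) (G : groupType)
    (g : completeNormedModType R) (L : lie_group G g)
    (g_reflexive : reflexive_space g) (lambda : dual_space g)
    (l : g -> R^o) (l_smooth : smooth l) :
  [/\ (* chi2 - chi1 = d Delta, which determines Delta up to a constant *)
      forall D : g * dual_space g -> R^o,
        potential_difference L lambda D <->
        exists c, forall p, D p = Delta p + c,
      (* E is a Morse family on g * g^* -> g^* *)
      morse_family (snd : g * dual_space g -> dual_space g) (E_lh l),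
      (* it generates a Lagrangian submanifold of T^*(g^* ) *)
      lagrangian (@canonical_form R (dual_space g))
        (generated (snd : g * dual_space g -> dual_space g) (E_lh l)),
      (* which is the set of the pairs (dl/dxi, xi), Lagrangian in g^* * g *)
      generated (snd : g * dual_space g -> dual_space g) (E_lh l) =
        (@covector R g) @` s_Tgstar l /\
      lagrangian (@canonical_Tgstar R g) (s_Tgstar l) &
      (* and whose image is s_zd *)
      omega_hat L @` s_Tgstar l = euler_poincare L l /\
      (omega_hat L @` s_Tgstar l) `&` zd L lambda = s_zd L lambda l].
Proof.
have g_sep := reflexive_separates g_reflexive.
split.
- by move=> D; exact: potential_differenceP.
- exact: morse_family_E.
- by rewrite generatedE//; exact: lagrangian_generated.
- split; first exact: generatedE.
  exact: lagrangian_s_Tgstar.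
have E : omega_hat L @` s_Tgstar l = euler_poincare L l.
  by rewrite /s_Tgstar image_comp.
by split; rewrite ?E// setIC.
Qed.
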